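(* $\mathbb{A}_{\leq 2}\not\leq_{BSS}\mathbb{A}_{\leq 1}$; that is, no oracle BSS machine with oracle $\mathbb{Q}$ decides the set of real algebraic numbers of degree at most $2$ over $\mathbb{Q}$.
   Context: BSS machines over $\mathbb{R}$: $\mathbb{R}^\infty$ is the set of finite tuples of reals. A BSS machine has a program with finitely many real constants (parameters); it can apply $+,-,\times,\div$ to cell contents, copy cells, overwrite a cell with $0$, and branch on whether a cell's content is $=0$, $<0$ or $>0$. An oracle BSS machine with oracle $B\subseteq\mathbb{R}^\infty$ may additionally branch on whether a previously computed tuple lies in $B$. $B\leq_{BSS}A$ means the characteristic function of $B$ is computed by some oracle BSS machine (with real parameters allowed) using oracle $A$. $\mathbb{A}_{\leq d}$ is the set of real numbers algebraic over $\mathbb{Q}$ of degree at most $d$ over $\mathbb{Q}$; thus $\mathbb{A}_{\leq 1}=\mathbb{Q}$. *)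

(* Defs.v *)
From HB Require Import structures.
From mathcomp Require Import all_boot all_order all_algebra.
From mathcomp Require Import boolp classical_sets reals numfun.

Set Implicit Arguments.
Unset Strict Implicit.
Unset Printing Implicit Defensive.

Import Order.TTheory GRing.Theory Num.Theory.

Local Open Scope classical_set_scope.
Local Open Scope ring_scope.

Inductive arith_op := Add | Sub | Mul | Div.

(* The tape is indexed by int and scanned by a movable head; every address     *)
(* [a], [b], [c] in an instruction is relative to the head, so that a program  *)
(* can process tuples of arbitrary length.                                     *)
Inductive instr (R : Type) :=
| Const of int & R                      (* [a] := parameter              *)
| Arith of arith_op & int & int & int   (* [a] := [b] op [c]             *)
| Copy of int & int                     (* [a] := [b]                    *)
| Zero of int                           (* [a] := 0                      *)
| Move of int
| Branch of int & nat & nat & nat       (* targets for [a] < 0, = 0, > 0 *)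
| Query of int & nat & nat.             (* targets for "in B", "not in B" *)

Definition program (R : Type) := seq (instr R).

Record config (R : Type) := Config { pc : nat; head : int; tape : int -> R }.

Section Machine.
Variable R : realType.
Implicit Types (t : int -> R) (v : seq R) (B : set (seq R)).

Definition set_cell t (i : int) (x : R) : int -> R :=
  fun j => if j == i then x else t j.

(* None when dividing by 0, where the machine gets stuck without halting. *)
Definition arith (op : arith_op) (x y : R) : option R :=
  match op with
  | Add => Some (x + y)
  | Sub => Some (x - y)
  | Mul => Some (x * y)
  | Div => if y == 0 then None else Some (x / y)
  end.

(* A tuple of length n is stored at address i as the real n in cell i followed *)
(* by its entries in cells i + 1, ..., i + n.                                  *)
Definition write_tuple v : int -> R :=
  fun i => match i with
  | Posz k => nth 0 ((size v)%:R :: v) k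
  | Negz _ => 0
  end.

Definition read_tuple t (i : int) : option (seq R) :=
  if t i \is a Num.nat
  then Some (mkseq (fun k => t (i + k.+1%:Z)) (Num.truncn (t i)))
  else None.

(* None when the machine is stuck or has halted. *)
Definition step B (p : program R) (s : config R) : option (config R) :=
  let: Config q h t := s in
  match onth p q with
  | None => None
  | Some (Const a x) => Some (Config q.+1 h (set_cell t (h + a) x))
  | Some (Arith op a b c) =>
      omap (fun x => Config q.+1 h (set_cell t (h + a) x))
        (arith op (t (h + b)) (t (h + c)))
  | Some (Copy a b) => Some (Config q.+1 h (set_cell t (h + a) (t (h + b))))
  | Some (Zero a) => Some (Config q.+1 h (set_cell t (h + a) 0))
  | Some (Move d) => Some (Config q.+1 (h + d) t)
  | Some (Branch a qneg qzero qpos) =>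
      let x := t (h + a) in
      Some (Config (if x < 0 then qneg else if x == 0 then qzero else qpos) h t)
  | Some (Query a qin qout) =>
      omap (fun w => Config (if w \in B then qin else qout) h t)
        (read_tuple t (h + a))
  end.

Definition init v : config R := Config 0 0 (write_tuple v).

Definition run B (p : program R) (n : nat) v : option (config R) :=
  iter n (obind (step B p)) (Some (init v)).

(* Halting is leaving the program; the output is the tuple under the head. *)
Definition computes B (p : program R) (f : seq R -> seq R) : Prop :=
  forall v, exists n s,
    [/\ run B p n v = Some s, (size p <= pc s)%N
      & read_tuple (tape s) (head s) = Some (f v)].

Definition charfun B (v : seq R) : seq R := [:: \1_B v].

Definition BSS_reducible B A : Prop :=
  exists p : program R, computes A p (charfun B).

Definition is_minpoly (p : {poly rat}) (x : R) : Prop :=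
  [/\ p \is monic, root (map_poly ratr p) x
    & forall q : {poly rat},
        q != 0 -> root (map_poly ratr q) x -> (size p <= size q)%N].

Definition alg_le (d : nat) : set (seq R) :=
  [set v | exists (x : R) (p : {poly rat}),
    [/\ v = [:: x], is_minpoly p x & ((size p).-1 <= d)%N]].

End Machine.

Arguments alg_le R d : clear implicits.

(* Main.v *)
(** Run the supposed machine on an input y that is generic over its parameters:
every tape cell then holds f(y) for a rational function f over the field
generated by the parameters, a test f(y) = 0 or f(y) = q with q rational
succeeds only if f is constant, and the machine rejects. The run on x is the
same run as long as x is close to y and f(x) is irrational for each of the
finitely many queried f with f(y) irrational, so it suffices to find such an x
of degree 2. We look for x = c + t sqrt(2) with c, t rational. If, for a fixed
c, f(c + t sqrt(2)) is rational for infinitely many t, then f(c + T sqrt(2)) is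
a ratio of rational polynomials in T. If this happens for two values of c, it
gives rational functions g, h over Q with g(T) = h(T + e), where e is a nonzero
rational multiple of sqrt(2); conjugation gives g(T) = h(T - e), so h has period
2e and is constant, and so is f. Hence each nonconstant f excludes at most one
c, and for any other c finitely many t. *)

From HB Require Import structures.
From mathcomp Require Import all_boot all_order all_algebra.
From mathcomp Require Import zify ring.
From mathcomp Require Import finmap boolp classical_sets cardinality reals.
From mathcomp Require Import numfun ereal normedtype derive measure.
From mathcomp Require Import lebesgue_measure.
Require Import Defs.

Set Implicit Arguments.
Unset Strict Implicit.
Unset Printing Implicit Defensive.

Import Order.TTheory GRing.Theory Num.Theory numFieldNormedType.Exports.

Local Open Scope classical_set_scope.
Local Open Scope ring_scope.

(** * Roots of polynomials, interpolation and conjugation *)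

Lemma infinite_roots_eq0 (K : idomainType) (T : choiceType) (f : T -> K)
    (A : set T) (p : {poly K}) :
  injective f -> infinite_set A -> (forall x, A x -> root p (f x)) -> p = 0.
Proof.
move=> f_inj /(infinite_set_fset (size p))[B BA szB] Ap.
apply/eqP/negPn/negP => p_neq0.
have : (size (map f B) < size p)%N.
  apply: max_poly_roots => //; last by rewrite map_inj_uniq ?fset_uniq.
  by apply/allP => _ /mapP[x xB ->]; apply/Ap/BA.
by rewrite size_map ltnNge szB.
Qed.

Lemma finite_roots (K : idomainType) (p : {poly K}) :
  p != 0 -> finite_set [set x | root p x].
Proof.
move=> p0; apply: contrapT => inf.
by move: p0; rewrite (@infinite_roots_eq0 _ _ id _ p (fun _ _ => id) inf) ?eqxx.
Qed.

Lemma mulmx_vander (K : nzRingType) (k m : nat) (u : 'rV[K]_k)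
    (t : 'I_m -> K) j :
  (u *m \matrix_(i < k, j < m) t j ^+ i) 0 j = (rVpoly u).[t j].
Proof.
rewrite mxE horner_poly; apply: eq_bigr => i _.
by rewrite mxE valK.
Qed.

(* Cauchy interpolation: the rational points give a homogeneous linear system *)
(* over rat for the coefficients of A and B, with more unknowns than          *)
(* equations but enough equations to force P * B = A * Q.                     *)
Lemma rational_interpolation (K : numFieldType) (P Q : {poly K}) (S : set rat) :
    Q != 0 -> infinite_set S ->
    (forall t, S t -> exists q, P.[ratr t] = ratr q * Q.[ratr t]) ->
  exists A B : {poly rat},
    B != 0 /\ P * map_poly ratr B = map_poly ratr A * Q.
Proof.
move=> Q0 Sinf SPQ.
have [N [PN QN]] : exists N, (size P <= N /\ size Q <= N)%N.
  by exists (maxn (size P) (size Q)); rewrite leq_maxl leq_maxr.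
(* A and B have N + 1 coefficients each, so there are 2N + 2 unknowns for 2N + 1 equations. As P * B
   - A * Q has size at most [m], having [m] roots forces it to vanish. *)
pose m := (N + N.+1)%N.
have /choice[q qP] :
    forall t, exists q, S t -> P.[ratr t] = ratr q * Q.[ratr t].
  move=> t; have [St|nSt] := pselect (S t); last by exists 0.
  by have [q hq] := SPQ t St; exists q.
have [X XS szX] := infinite_set_fset m Sinf.
pose t (j : 'I_m) := nth 0 X j.
have tX j : t j \in (X : seq rat) by rewrite mem_nth// (leq_trans _ szX).
have t_inj : injective t.
  move=> i j /eqP; rewrite nth_uniq ?fset_uniq ?(leq_trans _ szX)//.
  by move=> /eqP/val_inj.
pose V := \matrix_(i < N.+1, j < m) t j ^+ i.
(* A row (a, b) is in the left kernel of [M] iff a(t j) = q(t j) b(t j) for all j. *)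
pose M := col_mx V (- (V *m diag_mx (\row_j q (t j)))).
have : kermx M != 0.
  rewrite -mxrank_eq0 mxrank_ker subn_eq0 -ltnNge.
  by rewrite (leq_ltn_trans (rank_leq_col M))// /m; lia.
case/rowV0Pn => v /sub_kermxP; rewrite -[v]hsubmxK mul_row_col => vM v0.
set a := lsubmx v in vM v0 *; set b := rsubmx v in vM v0 *.
have AB j : (rVpoly a).[t j] = q (t j) * (rVpoly b).[t j].
  have /rowP/(_ j) := vM.
  rewrite mulmxN mulmxA mxE mulmx_vander mxE mul_mx_diag mxE mulmx_vander !mxE.
  by move=> /eqP; rewrite subr_eq0 mulrC => /eqP.
pose f := @ratr K.
have E : P * map_poly f (rVpoly b) = map_poly f (rVpoly a) * Q.
  apply/eqP; rewrite -subr_eq0; apply/negPn/negP => D0.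
  have : (m < size (P * map_poly f (rVpoly b) - map_poly f (rVpoly a) * Q)%R)%N.
    rewrite -[m]card_ord cardE -(size_map (f \o t)).
    apply: max_poly_roots => //; last first.
      rewrite map_inj_uniq ?enum_uniq//; apply: inj_comp => //.
      exact: fmorph_inj.
    apply/allP => _ /mapP[j _ ->]; rewrite rootE !hornerE /= /f !horner_map/=.
    rewrite qP; last by apply: XS; exact: tX.
    by rewrite AB rmorphM/=; apply/eqP; ring.
  rewrite ltnNge (leq_trans (size_polyD _ _))// geq_max size_polyN.
  have sz (u : 'rV[rat]_N.+1) : (size (rVpoly u) <= N.+1)%N by exact: size_poly.
  apply/andP; split; rewrite (leq_trans (size_polyMleq _ _))// size_map_poly.
    exact/(leq_trans (leq_pred _))/leq_add.
  by apply/(leq_trans (leq_pred _)); rewrite addnC leq_add.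
exists (rVpoly a), (rVpoly b); split => //.
apply: contra v0 => /eqP b0.
move: E; rewrite b0 rmorph0 mulr0 => /esym/eqP.
rewrite mulf_eq0 (negPf Q0) orbF map_poly_eq0 => /eqP a0.
by rewrite -[a]rVpolyK -[b]rVpolyK a0 b0 !linear0 row_mx0.
Qed.

(** Write F(x) = E(x^2) + x O(x^2). If O(d) were nonzero, F(e) = 0 would give the rational value e =
    - E(d) / O(d). So O(d) = 0, and F takes the same value at e and - e. *)
Lemma root_conjugate (K : numFieldType) (F : {poly rat}) (e : K) (d : rat) :
    e ^+ 2 = ratr d -> (forall q, e != ratr q) ->
  root (map_poly ratr F) e -> root (map_poly ratr F) (- e).
Proof.
move=> e2 eNQ.
have hornerF (x : K) : x ^+ 2 = ratr d ->
    (map_poly ratr F).[x] = ratr (even_poly F).[d] + ratr (odd_poly F).[d] * x.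
  move=> x2; rewrite -{1}[F]poly_even_odd rmorphD rmorphM/= !map_comp_poly.
  by rewrite map_polyXn map_polyX !hornerE !horner_comp !hornerE x2 !horner_map.
rewrite !rootE !hornerF ?sqrrN//; have [->|O0] := eqVneq (odd_poly F).[d] 0.
  by rewrite rmorph0 !mul0r.
rewrite addrC addr_eq0 => /eqP Oe.
have := eNQ (- (even_poly F).[d] / (odd_poly F).[d]).
rewrite fmorph_div rmorphN/= -Oe mulrC mulKf ?eqxx//.
by rewrite fmorph_eq0.
Qed.

Section Real.
Variable R : realType.
Implicit Types (x y z : R) (p : {poly R}).

(** * Avoiding countable sets, and periodic rational functions *)

(** Countable sets have Lebesgue measure 0, but [0, 1] has measure 1. *)
Lemma avoid_countable (A : set R) : countable A -> exists y, ~ A y.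
Proof.
move=> Acount; apply: contrapT => nA.
have : lebesgue_measure (`[0, 1]%classic : set R) = 0%E.
  apply: countable_lebesgue_measure0; apply: sub_countable Acount.
  by apply: subset_card_le => y _; apply: contrapT => nAy; apply: nA; exists y.
rewrite lebesgue_measure_itv/= lte_fin ltr01 oppr0 adde0 => /eqP.
by rewrite eqe oner_eq0.
Qed.

Lemma avoid_roots (I : countType) (F : I -> {poly R}) :
  exists y, forall i, F i != 0 -> (F i).[y] != 0.
Proof.
have [|y nAy] :=
    @avoid_countable (\bigcup_i [set x | F i != 0 /\ root (F i) x]).
  apply: bigcup_countable => [|i _]; first exact: countableP.
  have [->|Fi0] := eqVneq (F i) 0.
    by rewrite (_ : mkset _ = set0)//; apply/seteqP; split=> // x [/eqP].
  apply: finite_set_countable; apply: sub_finite_set (finite_roots Fi0).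
  by move=> x [].
by exists y => i Fi0; apply/negP => Fy; apply: nAy; exists i.
Qed.

(** On a progression x0 + n s that avoids the roots of Q, the ratio P / Q keeps its value k at x0,
    so P - k Q has infinitely many roots. *)
Lemma periodic_ratio_const (P Q : {poly R}) (s : R) :
    Q != 0 -> s != 0 ->
    (forall x, P.[x + s] * Q.[x] = P.[x] * Q.[x + s]) ->
  exists k, P = k *: Q.
Proof.
move=> Q0 s0 PQ.
have [x0 Qx0] : exists x0, forall n : nat, Q.[x0 + s *+ n] != 0.
  have [x0 Qx0] := avoid_roots (fun n : nat => Q \Po ('X + (s *+ n)%:P)).
  exists x0 => n; have := Qx0 n; rewrite horner_comp !hornerE; apply.
  by rewrite comp_poly_eq0// size_XaddC.
exists (P.[x0] / Q.[x0]); apply/eqP; rewrite -subr_eq0; apply/eqP.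
apply: (@infinite_roots_eq0 _ _ (fun n : nat => x0 + s *+ n) [set: nat]).
- by move=> m n /addrI/(mulrIn s0).
- exact: infinite_nat.
move=> n _; rewrite rootE !hornerE subr_eq0; apply/eqP; elim: n => [|n IH].
  by rewrite addr0 divfK//; have := Qx0 0%N; rewrite addr0.
apply: (mulIf (Qx0 n)); have := PQ (x0 + s *+ n).
by rewrite -addrA -mulrSr => ->; rewrite IH; ring.
Qed.

(** For g = A / B and h = A' / B' the last hypothesis is g(T) = h(T + e). Conjugation at each
    rational T gives g(T) = h(T - e), so h has period 2e. *)
Lemma rational_shift_ratio (A B A' B' : {poly rat}) (e : R) (d : rat) :
    e ^+ 2 = ratr d -> (forall q, e != ratr q) -> B != 0 -> B' != 0 ->
    map_poly ratr A * (map_poly ratr B' \Po ('X + e%:P)) =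
      (map_poly ratr A' \Po ('X + e%:P)) * map_poly ratr B ->
  exists k : R, map_poly ratr A' = k *: map_poly ratr B'.
Proof.
move=> e2 eNQ B0 B'0 AB.
have mp0 (C : {poly rat}) : C != 0 -> map_poly (ratr : rat -> R) C != 0.
  by rewrite map_poly_eq0.
(* F t has rational coefficients and vanishes at e, hence also at - e. *)
pose F (t : rat) :=
  A.[t] *: (B' \Po ('X + t%:P)) - B.[t] *: (A' \Po ('X + t%:P)).
have FE t x : (map_poly ratr (F t)).[x] =
    (map_poly ratr A).[ratr t] * (map_poly ratr B').[ratr t + x] -
    (map_poly ratr A').[ratr t + x] * (map_poly ratr B).[ratr t].
  rewrite rmorphB/= !map_polyZ/= !map_comp_poly !rmorphD/=.
  rewrite map_polyX map_polyC/=.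
  rewrite !hornerE !horner_comp !hornerE !horner_map/= (addrC x).
  by rewrite [_ * ratr B.[t]]mulrC.
have conj : map_poly ratr A * (map_poly ratr B' \Po ('X - e%:P)) =
      (map_poly ratr A' \Po ('X - e%:P)) * map_poly ratr B.
  apply/eqP; rewrite -subr_eq0; apply/eqP.
  apply: (@infinite_roots_eq0 _ _ (@ratr R) [set: rat]).
  - exact: fmorph_inj.
  - exact: infinite_rat.
  move=> t _; have : root (map_poly ratr (F t)) (- e).
    apply: root_conjugate e2 eNQ _; rewrite rootE FE.
    have /(congr1 (horner^~ (ratr t))) := AB.
    by rewrite !hornerE !horner_comp !hornerE => ->; rewrite subrr.
  by rewrite !rootE FE !hornerE !horner_comp !hornerE.
apply: (@periodic_ratio_const _ _ (e *+ 2)); first exact: mp0.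
  by rewrite mulrn_eq0/=; have := eNQ 0; rewrite rmorph0.
move=> x.
have : (map_poly ratr A' \Po ('X + e%:P)) * (map_poly ratr B' \Po ('X - e%:P)) =
    (map_poly ratr A' \Po ('X - e%:P)) * (map_poly ratr B' \Po ('X + e%:P)).
  apply: (mulfI (mp0 B B0)); move: AB conj.
  set C := (_ \Po ('X + _)); set D := (_ \Po ('X - _)) => AB conj.
  transitivity (map_poly ratr A * C * D); first by rewrite AB; ring.
  by rewrite mulrAC conj; ring.
(* At x + e the shifts by e and - e lead to x + 2e and x. *)
move=> /(congr1 (horner^~ (x + e))).
by rewrite !hornerE !horner_comp !hornerE addrK.
Qed.

(** * The lines c + t sqrt(2) with rational c and t *)

Definition theta : R := Num.sqrt 2.

Lemma theta2 : theta ^+ 2 = 2.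
Proof. by rewrite sqr_sqrtr. Qed.

(** If 2 d^2 = n^2 with n, d coprime, then d^2 divides n^2 and is coprime to it, so d = 1 and n^2 =
    2, which is impossible. *)
Lemma theta_irrational q : theta != ratr q.
Proof.
apply/negP => /eqP /(congr1 (fun x => x ^+ 2)); rewrite theta2 -rmorphXn/=.
rewrite -(ratr_nat R 2) => /(fmorph_inj _) q2.
have : 2 * denq q ^+ 2 = numq q ^+ 2.
  apply: (@intr_inj rat); rewrite rmorphM/= !rmorphXn/= numqE exprMn -q2.
  by rewrite mulrC.
move=> /(congr1 absz); rewrite abszM !abszX.
have [d0 cop] := (denq_gt0 q, coprime_num_den q); move: cop d0.
case: (denq q) => // d cop d0; move: (`|numq q|%N) cop => n cop dn.
have : coprime (d ^ 2) (n ^ 2) by rewrite coprimeXl// coprimeXr// coprime_sym.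
rewrite /coprime -dn gcdnMl => /eqP d1.
by move: dn; rewrite d1; case: n {cop} => [|[|n]]//; nia.
Qed.

Definition pencil (c t : rat) : R := ratr c + ratr t * theta.

(** Composing with it restricts a polynomial to the line of [c]. *)
Definition pencil_poly (c : rat) : {poly R} := (ratr c)%:P + theta *: 'X.

Lemma horner_pencil P c t :
  (P \Po pencil_poly c).[ratr t] = P.[pencil c t].
Proof. by rewrite horner_comp hornerD hornerC hornerZ hornerX mulrC. Qed.

Lemma size_pencil_poly c : size (pencil_poly c) = 2.
Proof.
have th0 : theta != 0 by have := theta_irrational 0; rewrite rmorph0.
rewrite /pencil_poly addrC size_polyDl ?size_scale ?size_polyX//.
by rewrite (leq_ltn_trans (size_polyC_leq1 _)).
Qed.

(** Two lines differ by a parameter shift that is a rational multiple of sqrt(2): the e of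
    [rational_shift_ratio]. *)
Lemma pencil_poly_shift c c' :
  pencil_poly c' \Po ('X + ((ratr c - ratr c') / theta)%:P) = pencil_poly c.
Proof.
have th0 : theta != 0 by have := theta_irrational 0; rewrite rmorph0.
rewrite /pencil_poly comp_polyD comp_polyC comp_polyZ comp_polyX scalerDr.
rewrite scale_polyC mulrC divfK// addrCA -polyCD (addrC (ratr c')) subrK.
by rewrite addrC.
Qed.

(** Interpolation on each line makes P / Q a ratio of rational polynomials there. For distinct
    lines, [rational_shift_ratio] makes it constant on the line of c', hence everywhere. *)
Lemma rational_lines_unique (P Q : {poly R}) (c c' : rat) :
    Q != 0 -> (forall k, P != k *: Q) ->
    infinite_set [set t | exists q, P.[pencil c t] = ratr q * Q.[pencil c t]] ->
    infinite_set
      [set t | exists q, P.[pencil c' t] = ratr q * Q.[pencil c' t]] ->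
  c = c'.
Proof.
move=> Q0 PQ inf inf'; apply/eqP/negPn/negP => cc'.
have th0 : theta != 0 by have := theta_irrational 0; rewrite rmorph0.
have Qc d : Q \Po pencil_poly d != 0 by rewrite comp_poly_eq0 ?size_pencil_poly.
have lineP d : infinite_set
    [set t | exists q, P.[pencil d t] = ratr q * Q.[pencil d t]] ->
    exists A B : {poly rat}, B != 0 /\
      (P \Po pencil_poly d) * map_poly ratr B =
      map_poly ratr A * (Q \Po pencil_poly d).
  move=> infd; apply: rational_interpolation infd _ => // t [q].
  by exists q; rewrite !horner_pencil.
have [A [B [B0 AB]]] := lineP _ inf.
have [A' [B' [B'0 AB']]] := lineP _ inf'.
pose e : R := (ratr c - ratr c') / theta.
have e2 : e ^+ 2 = ratr ((c - c') ^+ 2 / 2).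
  by rewrite expr_div_n theta2 fmorph_div rmorphXn rmorphB/= ratr_nat.
have eNQ q : e != ratr q.
  apply/negP => /eqP eq; have := theta_irrational ((c - c') / q).
  rewrite fmorph_div/= -eq /e rmorphB/= invf_div mulrC divfK ?eqxx//.
  by rewrite subr_eq0 fmorph_eq.
have [k A'kB'] : exists k : R, map_poly ratr A' = k *: map_poly ratr B'.
  apply: (rational_shift_ratio e2 eNQ B0 B'0).
  apply: (mulIf (Qc c)); move: AB'.
  move=> /(congr1 (comp_poly ('X + e%:P))).
  rewrite !comp_polyM -!comp_polyA pencil_poly_shift => AB'.
  move: AB AB'; set Qc0 := Q \Po _; set C := (_ \Po ('X + _)) => AB AB'.
  transitivity (map_poly ratr A * Qc0 * C); first exact: mulrAC.
  rewrite -AB mulrAC AB'; exact: mulrAC.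
have /eqP := PQ k; apply; apply/eqP; rewrite -subr_eq0.
have := comp_poly_eq0 (P - k *: Q) (q := pencil_poly c').
rewrite size_pencil_poly => <-//; rewrite comp_polyB comp_polyZ subr_eq0.
have B'n : map_poly (ratr : rat -> R) B' != 0 by rewrite map_poly_eq0.
by apply/eqP/(mulIf B'n); rewrite AB' A'kB' -!scalerAl mulrC.
Qed.

(** * A filter of sets that meet the lines *)

Lemma infinite_rat_nbhs (c : rat) y (V : set R) :
  nbhs y V -> infinite_set [set t | V (pencil c t)].
Proof.
move=> /nbhs_ballP[e /= e0 Ve]; have th0 : 0 < theta by rewrite sqrtr_gt0.
pose z := (y - ratr c) / theta.
have [q1] : exists q, ratr q \in `]z - e / theta, z[.
  by apply: rat_in_itvoo; rewrite gtrBl divr_gt0.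
rewrite in_itv/= => /andP[zq1 q1z].
have [q2] := rat_in_itvoo q1z; rewrite in_itv/= ltr_rat => /andP[q12 q2z].
(* Infinitely many rationals in ]q1, q2], all less than e / theta below z, the parameter of y. *)
pose f (n : nat) := q1 + (q2 - q1) / n.+1%:R.
have f_inj : injective f.
  move=> m n /addrI/mulfI; rewrite subr_eq0 gt_eqF// => /(_ isT)/invr_inj.
  by move/(mulrIn (oner_neq0 _)) => [].
move=> /(finite_preimage (in2W f_inj)) fin; apply: infinite_nat.
apply: sub_finite_set fin => n _ /=; apply: Ve.
have q1f : q1 < f n by rewrite ltrDl divr_gt0 ?subr_gt0.
have fq2 : f n <= q2.
  by rewrite -lerBrDl ler_pdivrMr// ler_peMr ?ler1n// subr_ge0 ltW.
have zf : z - ratr (f n) < e / theta.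
  by rewrite ltrBlDl -ltrBlDr (lt_le_trans zq1)// ler_rat ltW.
have fz : 0 < z - ratr (f n).
  by rewrite subr_gt0 (le_lt_trans _ q2z)// ler_rat.
have -> : pencil c (f n) = y - (z - ratr (f n)) * theta.
  by rewrite /pencil mulrBl /z divfK ?gt_eqF//; ring.
rewrite -ball_normE/= opprB addrC subrK gtr0_norm ?mulr_gt0//.
by rewrite -ltr_pdivlMr.
Qed.

(* The W-part may miss whole lines c + t sqrt(2), but only finitely many,
   since a queried rational function excludes up to one c. *)
Definition quad_nbhs y : set_system R := [set U | exists V W,
  [/\ nbhs y V, finite_set [set c | infinite_set [set t | ~ W (pencil c t)]]
    & V `&` W `<=` U]].

Lemma nbhs_quad_nbhs y U : nbhs y U -> quad_nbhs y U.
Proof.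
move=> Uy; exists U, setT; split => //.
apply: sub_finite_set (finite_set0 _) => c; apply.
by apply: sub_finite_set (finite_set0 _) => t; apply.
Qed.

(** A line that leaves W1 [&] W2 infinitely often leaves W1 or W2 infinitely often, so finitely many
    exceptional lines remain. *)
#[global] Instance quad_nbhs_filter y : Filter (quad_nbhs y).
Proof.
split.
- exact: (@nbhs_quad_nbhs y setT filterT).
- move=> U1 U2 [V1 [W1 [V1y W1f VW1]]] [V2 [W2 [V2y W2f VW2]]].
  exists (V1 `&` V2), (W1 `&` W2); split; first exact: filterI.
    have finU := conj W1f W2f; rewrite -finite_setU in finU.
    apply: sub_finite_set finU => c /= cinf.
    have [fin1|] := pselect (finite_set [set t | ~ W1 (pencil c t)]);
      last by left.
    right; apply: contra_not cinf => fin2.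
    have fin12 := conj fin1 fin2; rewrite -finite_setU in fin12.
    by apply: sub_finite_set fin12 => t /= /not_andP.
  by move=> x [[? ?] [? ?]]; split; [apply: VW1|apply: VW2].
- by move=> U1 U2 U12 [V [W [? ? VW]]]; exists V, W; split=> // x /VW/U12.
Qed.

(** First pick a nonexceptional c; then infinitely many t lead into V, and only finitely many of
    them miss W. *)
Lemma quad_nbhs_ex y U : quad_nbhs y U -> exists c t, U (pencil c t).
Proof.
move=> [V [W [Vy Wf VW]]].
have /infinite_setN0[c [_ /= /contrapT cfin]] := infinite_setD infinite_rat Wf.
have [t [Vt /contrapT Wt]] :=
  infinite_setN0 (infinite_setD (infinite_rat_nbhs (c := c) Vy) cfin).
by exists c, t; apply: VW.
Qed.

Lemma near_horner_neq0 P y : P.[y] != 0 -> quad_nbhs y [set x | P.[x] != 0].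
Proof.
move=> Py; apply: nbhs_quad_nbhs.
have : (fun x => P.[x]) @ y --> P.[y] by exact: continuous_horner.
by move/cvgr_neq0; apply.
Qed.

(** Either P / Q is constant where Q is nonzero, or by [rational_lines_unique] at most one line is
    exceptional. *)
Lemma near_irrational P Q y : Q.[y] != 0 -> ~ rational (P.[y] / Q.[y]) ->
  quad_nbhs y [set x | ~ rational (P.[x] / Q.[x])].
Proof.
move=> Qy PQy; have nearQ := near_horner_neq0 Qy.
have [[k PkQ]|PQ] := pselect (exists k, P = k *: Q).
  apply: (filterS _ nearQ) => x /= Qx; move: PQy.
  by rewrite PkQ !hornerZ !mulfK.
pose W := [set x | ~ exists q, P.[x] = ratr q * Q.[x]].
have : quad_nbhs y W; last first.
  apply: filterS2 nearQ => x /= Qx nPQ [q _ Eq]; apply: nPQ; exists q.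
  by rewrite Eq divfK.
exists setT, W; split => //; first exact: filterT.
have Q0 : Q != 0 by apply: contraNneq Qy => ->; rewrite horner0.
have PkQ k : P != k *: Q by apply/eqP => PkQ; apply: PQ; exists k.
have badE d : [set t | ~ W (pencil d t)] =
    [set t | exists q, P.[pencil d t] = ratr q * Q.[pencil d t]].
  by apply/seteqP; split => t /=; rewrite notE.
have [S0|/set0P[c Sc]] :=
    eqVneq [set d | infinite_set [set t | ~ W (pencil d t)]] set0.
  by rewrite S0; exact: finite_set0.
apply: sub_finite_set (finite_set1 c) => d Sd.
move: Sd Sc; rewrite /= !badE; exact: rational_lines_unique.
Qed.

(** * Generic points and algebraic numbers of low degree *)

(** S is the ring generated by the rationals, [cs] and 'X; y is transcendental over the field
    generated by [cs]. *)
Lemma generic_point (cs : seq R) : exists (S : set {poly R}) y,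
  [/\ forall c, c \in cs -> S c%:P, forall q, S (ratr q)%:P, S 'X,
      forall P Q, S P -> S Q -> [/\ S (P + Q), S (P - Q) & S (P * Q)]
    & forall P, S P -> P != 0 -> P.[y] != 0].
Proof.
pose gen (i : rat + nat) : {poly R} :=
  match i with
  | inl q => (ratr q)%:P
  | inr 0%N => 'X
  | inr n.+1 => (nth 0 cs n)%:P
  end.
pose eval := fix eval (e : GenTree.tree (rat + nat)) : {poly R} :=
  match e with
  | GenTree.Leaf i => gen i
  | GenTree.Node 0%N [:: a; b] => eval a + eval b
  | GenTree.Node 1%N [:: a; b] => eval a - eval b
  | GenTree.Node _ [:: a; b] => eval a * eval b
  | _ => 0
  end.
(* Terms form a countable type, so the ring they evaluate to is countable. *)
have [y yP] := avoid_roots eval; exists (range eval), y; split.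
- move=> c /(nthP 0)[n _ <-]; by exists (GenTree.Leaf (inr n.+1)).
- by move=> q; exists (GenTree.Leaf (inl q)).
- by exists (GenTree.Leaf (inr 0%N)).
- move=> _ _ [a _ <-] [b _ <-]; split.
  + by exists (GenTree.Node 0 [:: a; b]).
  + by exists (GenTree.Node 1 [:: a; b]).
  + by exists (GenTree.Node 2 [:: a; b]).
- by move=> _ [a _ <-]; exact: yP.
Qed.

(** An annihilating polynomial of least size, made monic, is the minimal polynomial. *)
Lemma alg_leP d x : alg_le R d [:: x] <-> exists p : {poly rat},
  [/\ p != 0, root (map_poly ratr p) x & (size p <= d.+1)%N].
Proof.
split=> [[z [p [[<-] [p_monic px _] pd]]]|[p0 [p0n0 p0x p0d]]].
  exists p; split => //; first exact: monic_neq0.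
  by move: pd; rewrite -ltnS; case: (size p).
pose P n := `[< exists p : {poly rat},
  [/\ p != 0, root (map_poly ratr p) x & size p = n] >].
have exP : exists n, P n by exists (size p0); apply/asboolP; exists p0.
case: (ex_minnP exP) => n /asboolP[p [pn0 px <-]] minp.
have lcn0 : (lead_coef p)^-1 != 0 by rewrite invr_eq0 lead_coef_eq0.
have sz : size ((lead_coef p)^-1 *: p) = size p by rewrite size_scale.
exists x, ((lead_coef p)^-1 *: p); split => //; last first.
  rewrite sz -ltnS prednK ?size_poly_gt0// (leq_trans _ p0d)// minp//.
  by apply/asboolP; exists p0.
split.
- by rewrite monicE lead_coefZ mulVf// lead_coef_eq0.
- by rewrite map_polyZ/= rootE hornerZ (eqP px) mulr0.
- by move=> q qn0 qx; rewrite sz; apply: minp; apply/asboolP; exists q.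
Qed.

Lemma alg_le1P x : alg_le R 1 [:: x] <-> rational x.
Proof.
rewrite alg_leP; split=> [[p [p0 px psz]]|[q _ <-]]; last first.
  exists ('X - q%:P); split; rewrite ?polyXsubC_eq0 ?size_XsubC//.
  by rewrite rmorphB/= map_polyX map_polyC/= root_XsubC.
have ppoly : p = (p`_1)%:P * 'X + (p`_0)%:P.
  apply/polyP => -[|[|i]]; rewrite coefD coefMX !coefC/= ?add0r ?addr0//.
  by rewrite nth_default// (leq_trans psz).
have p1 : p`_1 != 0.
  apply: contraNneq p0 => p1; move: px; rewrite ppoly p1 polyC0 mul0r add0r.
  rewrite map_polyC rootC/= fmorph_eq0 => /eqP->; by rewrite polyC0.
move: px; rewrite ppoly rmorphD rmorphM/= !map_polyC map_polyX rootE !hornerE.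
rewrite addr_eq0 /= => /eqP E; exists (- p`_0 / p`_1) => //.
by rewrite fmorph_div rmorphN/= -E mulrC mulKf// fmorph_eq0.
Qed.

Lemma alg_le2_pencil c t : alg_le R 2 [:: pencil c t].
Proof.
(* The equation (X - c)^2 = 2 t^2; [alg_leP] accepts it also when t = 0. *)
apply/alg_leP; exists (('X - c%:P) ^+ 2 - (2 * t ^+ 2)%:P).
have sz : size (('X - c%:P) ^+ 2 - (2 * t ^+ 2)%:P) = 3.
  rewrite size_polyDl ?size_exp_XsubC// size_polyN.
  by rewrite (leq_ltn_trans (size_polyC_leq1 _)).
split; rewrite ?sz//; first by rewrite -size_poly_eq0 sz.
rewrite rootE rmorphB/= expr2 rmorphM rmorphB/= map_polyX !map_polyC/=.
rewrite hornerD hornerM hornerN hornerD hornerN !hornerC hornerX.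
rewrite /pencil addrAC subrr add0r -expr2 exprMn theta2.
rewrite rmorphM rmorphXn/= ratr_nat.
by rewrite mulrC subrr.
Qed.

End Real.

(** * The run on a generic input and on nearby inputs *)

Section Simulation.
Variable R : realType.
Implicit Types (P Q : {poly R}) (x : R).

(** Unreduced pairs, so that numerator and denominator both stay in [S]. *)
Definition frac : Type := {poly R} * {poly R}.
Implicit Types (f g : frac) (T : int -> frac).

(* As division by 0 gives 0, products and quotients of fractions evaluate
   correctly even where a denominator vanishes; sums and differences do not. *)
Definition fval f x : R := f.1.[x] / f.2.[x].

Definition tape_at T x : int -> R := fun i => fval (T i) x.

Lemma tape_at_set_cell T i f x :
  set_cell (tape_at T x) i (fval f x) =
  tape_at (fun j => if j == i then f else T j) x.
Proof. by apply/funext => j; rewrite /set_cell /tape_at; case: ifP. Qed.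

Variables (S : set {poly R}) (y : R).
Hypothesis S_rat : forall q, S (ratr q)%:P.
Hypothesis S_X : S 'X.
Hypothesis S_ring : forall P Q, S P -> S Q ->
  [/\ S (P + Q), S (P - Q) & S (P * Q)].
Hypothesis S_generic : forall P, S P -> P != 0 -> P.[y] != 0.

Definition Sfrac f := [/\ S f.1, S f.2 & f.2 != 0].

Lemma Sfrac_denom f : Sfrac f -> f.2.[y] != 0.
Proof. by case=> _; exact: S_generic. Qed.

Lemma Sfrac_near_denom f : Sfrac f -> quad_nbhs y [set x | f.2.[x] != 0].
Proof. by move=> /Sfrac_denom/near_horner_neq0. Qed.

Lemma S_polyC1 : S 1.
Proof. by have := S_rat 1; rewrite rmorph1. Qed.

Lemma Sfrac_poly P : S P -> Sfrac (P, 1).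
Proof. by split=> //=; [exact: S_polyC1|exact: oner_neq0]. Qed.

Lemma fval_poly P x : fval (P, 1) x = P.[x].
Proof. by rewrite /fval hornerC divr1. Qed.

(** The polynomial f.1 - q f.2 is in [S] and vanishes at the generic y, so it is 0. *)
Lemma near_rat_value f (q : rat) : Sfrac f -> fval f y = ratr q ->
  quad_nbhs y [set x | fval f x = ratr q].
Proof.
move=> Sf fq; have fy := Sfrac_denom Sf.
have f1E : f.1 = (ratr q)%:P * f.2.
  apply/eqP; rewrite -subr_eq0; apply/negPn/negP.
  have [S1 S2 _] := Sf; have [_ _ Sq2] := S_ring (S_rat q) S2.
  have [_ SD _] := S_ring S1 Sq2.
  by move=> /(S_generic SD); rewrite !hornerE -fq /fval divfK// subrr eqxx.
apply: filterS (Sfrac_near_denom Sf) => x /= fx.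
by rewrite /fval f1E hornerM hornerC mulfK.
Qed.

Lemma near_fval_neq0 f : Sfrac f -> fval f y != 0 ->
  quad_nbhs y [set x | fval f x != 0].
Proof.
move=> Sf; rewrite /fval mulf_eq0 invr_eq0 negb_or => /andP[f1 f2].
apply: filterS2 (near_horner_neq0 f1) (near_horner_neq0 f2) => x /=.
by rewrite mulf_eq0 invr_eq0 negb_or => -> ->.
Qed.

Lemma fval_cvg f : Sfrac f -> fval f x @[x --> y] --> fval f y.
Proof.
move=> /Sfrac_denom fy; apply: cvgM; first exact: continuous_horner.
by apply: cvgV => //; exact: continuous_horner.
Qed.

(** Strict signs persist by continuity, the value 0 by [near_rat_value]. *)
Lemma near_branch (A : Type) f (a b c : A) : Sfrac f ->
  let target x := if fval f x < 0 then a else if fval f x == 0 then b else c in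
  quad_nbhs y [set x | target x = target y].
Proof.
move=> Sf target; rewrite /target; have [lt0|gt0|eq0] := ltgtP (fval f y) 0.
- apply: nbhs_quad_nbhs; move: (fval_cvg Sf) => /cvgr_lt/(_ _ lt0).
  by apply: filterS => x /= ->.
- apply: nbhs_quad_nbhs; move: (fval_cvg Sf) => /cvgr_gt/(_ _ gt0).
  by apply: filterS => x /= x0; rewrite ltNge ltW// gt_eqF.
- have := near_rat_value (q := 0) Sf; rewrite rmorph0 => /(_ eq0).
  by apply: filterS => x /= ->; rewrite ltxx eqxx.
Qed.

Lemma near_arith op f g z : Sfrac f -> Sfrac g ->
    arith op (fval f y) (fval g y) = Some z ->
  exists h, [/\ Sfrac h, fval h y = z &
    quad_nbhs y [set x | arith op (fval f x) (fval g x) = Some (fval h x)]].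
Proof.
move=> Sf Sg; have [S1f S2f f0] := Sf; have [S1g S2g g0] := Sg.
have nf := Sfrac_near_denom Sf; have ng := Sfrac_near_denom Sg.
have fy := Sfrac_denom Sf; have gy := Sfrac_denom Sg.
have [_ _ Sff] := S_ring S1f S2g; have [_ _ Sgg] := S_ring S1g S2f.
have [SA SB _] := S_ring Sff Sgg; have [_ _ Sd] := S_ring S2f S2g.
have [_ _ Sn] := S_ring S1f S1g.
have [_ _ Sfg] := S_ring S2f S1g.
have d0 : f.2 * g.2 != 0 by rewrite mulf_neq0.
case: op => /=.
- move=> [<-]; exists (f.1 * g.2 + g.1 * f.2, f.2 * g.2).
  have E x : f.2.[x] != 0 -> g.2.[x] != 0 -> fval f x + fval g x =
      fval (f.1 * g.2 + g.1 * f.2, f.2 * g.2) x.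
    by move=> fx gx; rewrite /fval/= !hornerE addf_div.
  by split; [split|rewrite E|apply: filterS2 nf ng => x /= *; rewrite E].
- move=> [<-]; exists (f.1 * g.2 - g.1 * f.2, f.2 * g.2).
  have E x : f.2.[x] != 0 -> g.2.[x] != 0 -> fval f x - fval g x =
      fval (f.1 * g.2 - g.1 * f.2, f.2 * g.2) x.
    by move=> fx gx; rewrite /fval/= !hornerE -mulNr addf_div// mulNr.
  by split; [split|rewrite E|apply: filterS2 nf ng => x /= *; rewrite E].
- move=> [<-]; exists (f.1 * g.1, f.2 * g.2).
  have E x : fval f x * fval g x = fval (f.1 * g.1, f.2 * g.2) x.
    by rewrite /fval/= !hornerM mulf_div.
  by split; [split|rewrite E|apply: filterS nf => x /= *; rewrite E].
(* As g is nonzero at y, [g.1] is a nonzero polynomial, and nearby inputs do not get stuck. *)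
- case: ifPn => // gy0 [<-]; exists (f.1 * g.2, f.2 * g.1).
  have E x : fval f x / fval g x = fval (f.1 * g.2, f.2 * g.1) x.
    by rewrite /fval/= !hornerM invf_div mulf_div.
  split; [split=> //=|by rewrite E|].
    rewrite mulf_neq0//; apply: contraNneq gy0 => g10.
    by rewrite /fval g10 horner0 mul0r.
  by apply: filterS (near_fval_neq0 Sg gy0) => x /= /negPf ->; rewrite E.
Qed.

Lemma near_alg_le1 f : Sfrac f ->
  quad_nbhs y [set x |
    ([:: fval f x] \in alg_le R 1) = ([:: fval f y] \in alg_le R 1)].
Proof.
move=> Sf; have [[q _ fq]|fy] := pselect (rational (fval f y)).
  apply: filterS (near_rat_value Sf (esym fq)) => x /= ->.
  by rewrite -fq.
have := near_irrational (Sfrac_denom Sf) fy; apply: filterS => x /= fx.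
by rewrite !memNset// => /alg_le1P.
Qed.

(** The length is a natural number at y, hence constant nearby. Only tuples of length 1 can be in
    the oracle, so just the first entry has to be controlled. *)
Lemma near_query T i w : (forall j, Sfrac (T j)) ->
    read_tuple (tape_at T y) i = Some w ->
  quad_nbhs y [set x | exists2 v, read_tuple (tape_at T x) i = Some v &
    (v \in alg_le R 1) = (w \in alg_le R 1)].
Proof.
move=> ST; rewrite {1}/read_tuple; case: ifP => // /natrP[n Tn] [<-].
have Tnq : fval (T i) y = ratr n%:R by rewrite ratr_nat.
have nx := near_rat_value (ST i) Tnq.
apply: filterS2 nx (near_alg_le1 (ST (i + 1%:Z))) => x /= Tx alg1.
exists (mkseq (fun k => tape_at T x (i + k.+1%:Z)) n).
  by rewrite /read_tuple /tape_at Tx ratr_nat natr_nat natrK.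
rewrite Tn natrK; case: n {Tn Tnq Tx} => [|[|n]] //=.
by rewrite !memNset// => -[? [? []]].
Qed.

Fixpoint params (p : program R) : seq R :=
  match p with
  | [::] => [::]
  | Const _ c :: p' => c :: params p'
  | _ :: p' => params p'
  end.

Lemma onth_params p q a c : onth p q = Some (Const a c) -> c \in params p.
Proof.
elim: p q => [|i p IH] [|q]//= => [[->]|/IH cp]; first exact: mem_head.
by case: i => //= *; rewrite inE cp orbT.
Qed.

Variable p : program R.
Hypothesis S_params : forall c, c \in params p -> S c%:P.

Lemma near_step T q h s : (forall j, Sfrac (T j)) ->
    step (alg_le R 1) p (Config q h (tape_at T y)) = Some s ->
  exists T', [/\ forall j, Sfrac (T' j), tape s = tape_at T' y &
    quad_nbhs y [set x | step (alg_le R 1) p (Config q h (tape_at T x)) =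
      Some (Config (pc s) (head s) (tape_at T' x))]].
Proof.
move=> ST; rewrite /step; case E : (onth p q) =>
  [[a c|op a b c|a b|a|d|a qn qz qp|a qin qout]|]//.
- move=> [<-]; exists (fun j => if j == h + a then (c%:P, 1) else T j).
  have fE x : c = fval (c%:P, 1) x by rewrite fval_poly hornerC.
  split=> [j||] /=.
  + by case: ifP => // _; apply/Sfrac_poly/S_params/onth_params/E.
  + by rewrite -tape_at_set_cell -fE.
  + by apply: filterE => x /=; rewrite -tape_at_set_cell -fE.
- case Ez : arith => [z|]//= [<-].
  have [f [Sf fz nf]] := near_arith (ST _) (ST _) Ez.
  exists (fun j => if j == h + a then f else T j); split=> [j||] /=.
  + by case: ifP.
  + by rewrite -tape_at_set_cell fz.
  + by apply: filterS nf => x /= ->; rewrite -tape_at_set_cell.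
- move=> [<-]; exists (fun j => if j == h + a then T (h + b) else T j).
  split=> [j||] /=; first by case: ifP.
  + by rewrite -tape_at_set_cell.
  + by apply: filterE => x /=; rewrite -tape_at_set_cell.
- move=> [<-]; exists (fun j => if j == h + a then (0, 1) else T j).
  have fE x : 0 = fval (0, 1) x by rewrite fval_poly horner0.
  split=> [j||] /=.
  + case: ifP => // _; apply: Sfrac_poly.
    by have := S_rat 0; rewrite rmorph0.
  + by rewrite -tape_at_set_cell -fE.
  + by apply: filterE => x /=; rewrite -tape_at_set_cell -fE.
- by move=> [<-]; exists T; split => //; exact: filterE.
- move=> [<-]; exists T; split => //=.
  by apply: filterS (near_branch qn qz qp (ST (h + a))) => x /= ->.
- case Ew : read_tuple => [w|]//= [<-]; exists T; split => //=.
  by apply: filterS (near_query ST Ew) => x /= [v -> /= ->].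
Qed.

(** A finite run imposes finitely many conditions, and the filter is closed under their
    intersection. *)
Lemma near_run n s : run (alg_le R 1) p n [:: y] = Some s ->
  exists T, [/\ forall j, Sfrac (T j), tape s = tape_at T y &
    quad_nbhs y [set x | run (alg_le R 1) p n [:: x] =
      Some (Config (pc s) (head s) (tape_at T x))]].
Proof.
elim: n s => [|n IH] s.
  pose T0 (i : int) : frac :=
    if i == 0 then (1, 1) else if i == 1 then ('X, 1) else (0, 1).
  move=> [<-]; exists T0.
  have init_tape x : write_tuple [:: x] = tape_at T0 x.
    apply/funext => -[[|[|k]]|k]; rewrite /tape_at /= fval_poly.
    - by rewrite hornerC.
    - by rewrite hornerX.
    - by rewrite horner0 nth_nil.
    - by rewrite horner0.
  split=> [j||] /=.
  + rewrite /T0; case: ifP => _; first exact/Sfrac_poly/S_polyC1.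
    case: ifP => _; first exact/Sfrac_poly.
    by apply: Sfrac_poly; have := S_rat 0; rewrite rmorph0.
  + exact: init_tape.
  + by apply: filterE => x /=; rewrite /run/= /init init_tape.
rewrite {1}/run iterS -/(run _ _ _ _); case Er : run => [[q h t]|]//= Es.
have [T [ST /= tE nT]] := IH _ Er; rewrite tE in Es.
have [T' [ST' sE nT']] := near_step ST Es.
exists T'; split=> //; apply: filterS2 nT nT' => x /= rx sx.
by rewrite -/(run (alg_le R 1) p n [:: x]) rx.
Qed.

End Simulation.

(** * Uniqueness of the halting configuration and the contradiction *)

(** Any step after halting yields [None], so only one step count ends in a halted configuration. *)
Lemma run_halted_uniq (R : realType) (B : set (seq R)) p v m n s s' :
    run B p m v = Some s -> run B p n v = Some s' ->
    (size p <= pc s)%N -> (size p <= pc s')%N -> s = s'.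
Proof.
have stuck k l r : run B p k v = Some r -> (size p <= pc r)%N ->
    run B p (l.+1 + k) v = None.
  move=> rk hr; rewrite /run addSn iterS iterD -/(run _ _ _ _) rk.
  elim: l => [|l IH] /=.
    by case: r hr {rk} => q h t /= hq; rewrite onth_default.
  by rewrite IH.
move=> rm rn hs hs'; case: (ltngtP m n) => [mn|nm|eq_mn].
- by have := stuck m (n - m.+1)%N _ rm hs; rewrite addSnnS subnK// rn.
- by have := stuck n (m - n.+1)%N _ rn hs'; rewrite addSnnS subnK// rm.
- by move: rn; rewrite -eq_mn rm => -[].
Qed.

Theorem theorem3p1 (R : realType) :
  ~ BSS_reducible (alg_le R 2) (alg_le R 1).
Proof.
move=> [p pP].
have [S [y [Sc Srat SX Sring Sgen]]] := generic_point (params p).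
have ynotin : ~ alg_le R 2 [:: y].
  move=> /alg_leP[P [P0 Py _]].
  (* All rational polynomials are in S, so y is transcendental. *)
  have SP : S (map_poly ratr P).
    elim/poly_ind: P {P0 Py} => [|P c IH].
      by rewrite rmorph0; have := Srat 0; rewrite rmorph0.
    rewrite rmorphD rmorphM/= map_polyX map_polyC/=.
    by have [_ _ SPX] := Sring _ _ IH SX; have [] := Sring _ _ SPX (Srat c).
  have := Sgen _ SP; rewrite map_poly_eq0 => /(_ P0).
  by rewrite -rootE Py.
have [n [s [rs hs]]] := pP [:: y]; rewrite /charfun indicE memNset//= => out.
have [T [ST sE nearT]] := near_run Srat SX Sring Sgen Sc rs.
(* The output on y is [:: 0], stored as length 1 followed by 0. *)
have [size_out cell_out] :
    fval (T (head s)) y = 1 /\ fval (T (head s + 1)) y = 0.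
  move: out; rewrite /read_tuple sE; case: ifP => // /natrP[k Tk].
  rewrite Tk natrK => -[]; case: k Tk => [|[|k]]//= Tk [T1].
  by rewrite -[LHS]/(tape_at T y (head s)) Tk.
have near1 := near_rat_value Srat Sring Sgen (q := 1) (ST (head s)).
rewrite rmorph1 in near1; have {}near1 := near1 size_out.
have near0 := near_rat_value Srat Sring Sgen (q := 0) (ST (head s + 1)).
rewrite rmorph0 in near0; have {}near0 := near0 cell_out.
(* Some x of degree at most 2 follows the run on y and also outputs [:: 0]. *)
have [c [t [rx]]] := quad_nbhs_ex (filterI nearT (filterI near1 near0)).
set x := pencil R c t in rx * => -[x1 x0].
have [n' [s' [rs' hs']]] := pP [:: x].
have <- := run_halted_uniq rx rs' hs hs'.
rewrite /read_tuple/= /tape_at x1 (_ : 1 \is a Num.nat)// truncn1/=.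
rewrite /mkseq/= x0 /charfun indicE mem_set; last exact: alg_le2_pencil.
by move=> [] /eqP; rewrite eq_sym oner_eq0.
Qed.
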